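(* Let $p>3$ be a prime. Then $$\sum_{k=0}^{[p/6]}\binom{[\frac p3]}k\binom{[\frac p6]}k\Big(-\frac9{16}\Big)^k\equiv\begin{cases}L\pmod p&\text{if }p\equiv1\pmod3,\text{ where }4p=L^2+27M^2,\ L,M\in\mathbb Z,\ 3\mid L-2,\\0\pmod p&\text{if }p\equiv2\pmod3.\end{cases}$$
   Context: $[x]$ is the floor of $x$; congruences mod $p$ are among rationals with denominator coprime to $p$.
   Formalization: The prime p = 5 is excluded: there [p/6] = 0, so the sum equals 1, which is not congruent to 0 mod 5 although 5 ≡ 2 mod 3; the claim is proved for all other primes p > 3. *)

(* Defs.v *)
From mathcomp Require Import all_boot all_order all_algebra.

Set Implicit Arguments.
Unset Strict Implicit.
Unset Printing Implicit Defensive.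

Import Order.TTheory GRing.Theory Num.Theory.
Local Open Scope ring_scope.

Definition p_integral (p : nat) (x : rat) : bool := coprimez (denq x) p%:Z.

(* The congruence is only meaningful between p-integral rationals, so
   p-integrality of both sides is part of what it asserts. *)
Definition ratcong (p : nat) (x y : rat) : Prop :=
  [/\ p_integral p x, p_integral p y &
      exists2 z : rat, p_integral p z & x - y = p%:R * z].

Definition floor_binom_sum (p : nat) : rat :=
  \sum_(0 <= k < (p %/ 6).+1)
     ('C(p %/ 3, k))%:R * ('C(p %/ 6, k))%:R * (- (9%:R / 16%:R)) ^+ k.

(* At p = 5 the sum is reduced to its k = 0 term, so although 5 = 2 mod 3 it is
   not congruent to 0: this prime has to be excluded. *)
Lemma floor_binom_sum_5 : ~ ratcong 5 (floor_binom_sum 5) 0.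
Proof.
have -> : floor_binom_sum 5 = 1.
  by rewrite /floor_binom_sum big_nat1 !bin0 expr0 !mulr1.
case=> _ _ [z hz]; rewrite subr0 => e.
have hz' : z = 5%:R^-1 by apply: (@mulfI _ 5%:R) => //; rewrite -e divff.
by move: hz; rewrite hz'.
Qed.

(* Main.v *)
(* Modulo p the sum is F(1/3,1/6;1;u) (p = 1 mod 3) or F(2/3,5/6;1;u)
   (p = 2 mod 3) at u = -9/16.  A quadratic transformation with u = 4x(1-x),
   x = -1/8, turns it, up to the factor 1 - 2x = 5/4 in the second case, into
   the truncation of F(1/3,2/3;1;-1/8) = sum_k (3k)!/k!^3 (-1/216)^k.  This is
   the Hasse invariant of the Hesse cubic x^3 + y^3 + z^3 + 6xyz, i.e. minus the
   sum over F_p^3 of the (p-1)-st power of that form.  The cubic is a form of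
   the Fermat cubic: linearly equivalent to it when p = 1 mod 3, and equivalent
   to u^3 + c(s,t) when p = 2 mod 3.  In the latter case cubing is bijective and
   the sum vanishes; in the former it gives the binomial coefficient
   C(2(p-1)/3, (p-1)/3), which by the theorem of Jacobi is read off the Jacobi
   sum of a cubic character. *)
Require Import Defs.
From mathcomp Require Import all_boot all_order all_algebra.
From mathcomp Require Import fingroup cyclic finfield.
From mathcomp Require Import ring lra zify.

Import Order.TTheory GRing.Theory Num.Theory.
Local Open Scope ring_scope.

(** * Power sums over a finite field *)

Lemma natr_card (F : finFieldType) : #|F|%:R = 0 :> F.
Proof. by rewrite -FinRing.zmodXgE -cardsT expg_cardG ?inE. Qed.

Lemma card_pred_gt0 (F : finFieldType) : (0 < #|F|.-1)%N.
Proof. by rewrite -subn1 subn_gt0 finNzRing_gt1. Qed.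

Lemma card_predK (F : finFieldType) : #|F|.-1.+1 = #|F|.
Proof. exact: ltn_predK (finNzRing_gt1 F). Qed.

Lemma expf_card_pred (F : finFieldType) (x : F) : x != 0 -> x ^+ #|F|.-1 = 1.
Proof.
move=> nz_x; apply: (mulfI nz_x).
by rewrite -exprS mulr1 card_predK expf_card.
Qed.

Lemma primitive_root_card (F : finFieldType) :
  exists g : F, #|F|.-1.-primitive_root g.
Proof.
pose s := enum (predC1 (0 : F)).
have size_s : size s = #|F|.-1 by rewrite -cardE cardC1.
have : has #|F|.-1.-primitive_root s.
  apply: has_prim_root; rewrite ?size_s ?enum_uniq ?card_pred_gt0 //.
  apply/allP => x; rewrite mem_enum unity_rootE => nz_x.
  by rewrite expf_card_pred.
by case/hasP => g _ ?; exists g.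
Qed.

(** Multiplying [x] by a generator [g] scales the sum by [g ^+ k], so it vanishes unless that factor
    is 1. For [k = 0] the convention [0 ^+ 0 = 1] makes the sum [#|F|], which is 0 in [F]. *)
Lemma sum_expr_card (F : finFieldType) (k : nat) :
  \sum_(x : F) x ^+ k = - ((0 < k)%N && (#|F|.-1 %| k)%N)%:R.
Proof.
case: k => [|k] /=.
  rewrite oppr0 -[RHS](natr_card F) -sum1_card natr_sum.
  by apply: eq_bigr => x _; rewrite expr0.
have [g prim_g] := primitive_root_card F.
have nz_g : g != 0.
  apply/eqP => g0; move/eqP: (prim_expr_order prim_g).
  by rewrite g0 expr0n gtn_eqF ?card_pred_gt0 // eq_sym oner_eq0.
case: (boolP (_ %| _)%N) => dvd_k /=.
  rewrite (bigD1 0) //= expr0n add0r (eq_bigr (fun=> 1)); last first.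
    by move=> x nz_x; case/dvdnP: dvd_k => c ->; rewrite mulnC exprM
      expf_card_pred // expr1n.
  rewrite sumr_const cardC1; apply/eqP; rewrite eq_sym -subr_eq0 -opprD.
  by rewrite oppr_eq0 -natrD add1n card_predK natr_card.
rewrite oppr0; apply/eqP; set S := bigop _ _ _.
have : S * (1 - g ^+ k.+1) == 0.
  rewrite mulrBr mulr1 subr_eq0 {1}/S (reindex (fun x => g * x)) /=.
    by rewrite mulr_suml; apply/eqP/eq_bigr => x _; rewrite exprMn mulrC.
  by exists (fun x => g^-1 * x) => x _; rewrite (mulKf, mulVKf).
rewrite mulf_eq0 => /orP[//|].
by rewrite subr_eq0 eq_sym -(prim_order_dvd prim_g) (negPf dvd_k).
Qed.

(** A nonzero power sum needs a positive multiple of [#|F|.-1] as exponent; three of these with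
    total [3 * #|F|.-1] are all equal to it. *)
Lemma sum_expr3_card (F : finFieldType) (i j k : nat) :
  (i + j + k = 3 * #|F|.-1)%N ->
  (\sum_(x : F) x ^+ i) * (\sum_(x : F) x ^+ j) * (\sum_(x : F) x ^+ k)
    = - [&& i == #|F|.-1, j == #|F|.-1 & k == #|F|.-1]%:R.
Proof.
have := card_pred_gt0 F; set N := #|F|.-1 => N_gt0 ijk.
have dvdE l : (0 < l)%N && (N %| l)%N -> (N <= l)%N.
  by case/andP => l0 /dvdn_leq->.
rewrite !sum_expr_card -/N; case: and3P => [[/eqP-> /eqP-> /eqP->]|H].
  by rewrite N_gt0 dvdnn /=; ring.
case: (boolP ((0 < i)%N && _)) => [/dvdE Hi|_]; last by rewrite oppr0 !mul0r.
case: (boolP ((0 < j)%N && _)) => [/dvdE Hj|_]; last first.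
  by rewrite oppr0 mulr0 mul0r.
case: (boolP ((0 < k)%N && _)) => [/dvdE Hk|_]; last by rewrite oppr0 mulr0.
by case: H; split; apply/eqP; lia.
Qed.

(** * Sums of the [(q - 1)]-st power of a ternary cubic *)

(** The bound [m] is free, so that nested expansions range over independent indices and their sums
    can be exchanged. *)
Lemma exprDn_wide (R : comNzRingType) (x y : R) (n m : nat) : (n < m)%N ->
  (x + y) ^+ n = \sum_(i < m) 'C(n, i)%:R * (x ^+ (n - i) * y ^+ i).
Proof.
move=> lt_nm; rewrite exprDn.
under eq_bigr => i _ do rewrite -mulr_natl.
rewrite (big_ord_widen m (fun i => 'C(n, i)%:R * (x ^+ (n - i) * y ^+ i))) //.
rewrite big_mkcond; apply: eq_bigr => i _; rewrite ltnS.
by case: leqP => // lt_ni; rewrite bin_small ?mul0r.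
Qed.

Lemma sum3_separate (R : comNzRingType) (T I : finType) (a : I -> R)
    (f g h : I -> T -> R) :
  \sum_x \sum_y \sum_z \sum_i a i * (f i x * g i y * h i z)
  = \sum_i a i * ((\sum_x f i x) * (\sum_y g i y) * (\sum_z h i z)).
Proof.
rewrite [RHS](eq_bigr (fun i => \sum_x \sum_y \sum_z
    a i * (f i x * g i y * h i z))) => [|i _]; last first.
  rewrite mulr_suml mulr_suml mulr_sumr; apply: eq_bigr => x _.
  rewrite -mulrA mulr_suml !mulr_sumr; apply: eq_bigr => y _.
  by rewrite !mulr_sumr; apply: eq_bigr => z _; rewrite -!mulrA.
rewrite [RHS]exchange_big; apply: eq_bigr => x _.
rewrite [RHS]exchange_big; apply: eq_bigr => y _.
by rewrite [RHS]exchange_big.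
Qed.

(* The exponents of [x], [y], [z] add up to [3 (q - 1)], so only the monomial
   [(x y z)^(q - 1)] survives the summation. *)
Lemma sum_cubic_pencil (F : finFieldType) (c : F) :
  \sum_(x : F) \sum_(y : F) \sum_(z : F)
     (x ^+ 3 + y ^+ 3 + z ^+ 3 + c * (x * y * z)) ^+ #|F|.-1
  = - \sum_(l < #|F|) 'C(#|F|.-1, 3 * l)%:R * 'C(3 * l, 2 * l)%:R
        * 'C(2 * l, l)%:R * c ^+ (#|F|.-1 - 3 * l).
Proof.
have ltNF : (#|F|.-1 < #|F|)%N by rewrite card_predK.
have expr3 := @sum_expr3_card F.
set N := #|F|.-1 in ltNF expr3 *; set q := #|F| in ltNF *.
have leN (i : 'I_q) : (i <= N)%N by rewrite -ltnS card_predK.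
(* Of the [N] factors, [j] contribute a cube, [i] of these one from [y ^+ 3 + z ^+ 3], and [l] of
   those [z ^+ 3]. *)
pose a (j i l : nat) : F :=
  'C(N, j)%:R * 'C(j, i)%:R * 'C(i, l)%:R * c ^+ (N - j).
pose b (t : 'I_q * ('I_q * 'I_q)) := a t.1 t.2.1 t.2.2.
pose e1 (t : 'I_q * ('I_q * 'I_q)) := (N - t.1 + 3 * (t.1 - t.2.1))%N.
pose e2 (t : 'I_q * ('I_q * 'I_q)) := (N - t.1 + 3 * (t.2.1 - t.2.2))%N.
pose e3 (t : 'I_q * ('I_q * 'I_q)) := (N - t.1 + 3 * t.2.2)%N.
have expand x y z : (x ^+ 3 + y ^+ 3 + z ^+ 3 + c * (x * y * z)) ^+ N =
    \sum_t b t * (x ^+ e1 t * y ^+ e2 t * z ^+ e3 t).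
  rewrite addrC (exprDn_wide _ _ _ _ _ ltNF).
  transitivity (\sum_(j < q) \sum_(i < q) \sum_(l < q)
    a j i l * (x ^+ (N - j + 3 * (j - i)) * y ^+ (N - j + 3 * (i - l))
     * z ^+ (N - j + 3 * l))); last first.
    by under eq_bigr => j _ do rewrite pair_big; rewrite pair_big.
  apply: eq_bigr => j _; have lt_jq := ltn_ord j.
  rewrite -addrA (exprDn_wide _ _ _ _ _ lt_jq) !mulr_sumr.
  apply: eq_bigr => i _; have lt_iq := ltn_ord i.
  rewrite (exprDn_wide _ _ _ _ _ lt_iq) !mulr_sumr.
  apply: eq_bigr => l _; rewrite /a !(exprD _ (N - j)) !exprM !exprMn; ring.
under eq_bigr => x _ do under eq_bigr => y _ do under eq_bigr => z _ do
  rewrite expand.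
rewrite sum3_separate /b /e1 /e2 /e3.
(* The three exponents all equal [N] exactly when [j = 3 l] and [i = 2 l]. *)
transitivity (\sum_(j < q) \sum_(i < q) \sum_(l < q)
    - (a j i l * ((i == 2 * l :> nat) && (j == 3 * l :> nat))%N%:R)).
  rewrite [RHS](eq_bigr (fun j : 'I_q => \sum_(t : 'I_q * 'I_q)
    - (a j t.1 t.2 * ((t.1 == 2 * t.2 :> nat) && (j == 3 * t.2 :> nat))%N%:R)));
    last by move=> j _; rewrite pair_big.
  rewrite pair_big; apply: eq_bigr => -[j [i l]] _ /=.
  have leNj := leN j.
  case: (leqP i j) => [le_ij|?]; last first.
    by rewrite /a (@bin_small j) // mulr0 !mul0r oppr0.
  case: (leqP l i) => [le_li|?]; last first.
    by rewrite /a (@bin_small i) // mulr0 !mul0r oppr0.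
  rewrite expr3; last lia.
  by rewrite mulrN; congr (- (_ * (nat_of_bool _)%:R)); lia.
rewrite exchange_big; under eq_bigr => i _ do rewrite exchange_big.
rewrite exchange_big -sumrN; apply: eq_bigr => l _.
case: (leqP q (3 * l)) => [le_q|lt_q].
  rewrite bin_small; last exact: leq_trans ltNF le_q.
  rewrite !mul0r oppr0 big1 // => i _; rewrite big1 // => j _.
  have ltjq := ltn_ord j.
  by rewrite (ltn_eqF (leq_trans ltjq le_q)) andbF mulr0 oppr0.
have lt2_q : (2 * l < q)%N by apply: leq_ltn_trans lt_q; lia.
rewrite (bigD1 (Ordinal lt2_q)) //= (bigD1 (Ordinal lt_q)) //= !eqxx mulr1.
rewrite big1 => [|j /negPf nj].
  rewrite addr0 big1 ?addr0 // => i /negPf ni.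
  by rewrite big1 // => j _; rewrite -val_eqE /= in ni; rewrite ni mulr0 oppr0.
by rewrite -val_eqE /= in nj; rewrite nj andbF mulr0 oppr0.
Qed.

(* For [u = x + y + z], [s = x - z], [t = y - z] and [w^2 + w + 1 = 0], three
   times the cubic is [u^3 + (s + w t)^3 + (s + w^2 t)^3]. *)
Lemma sum_hesse_change (F : finFieldType) : 3%:R != 0 :> F ->
  \sum_(x : F) \sum_(y : F) \sum_(z : F)
     (x ^+ 3 + y ^+ 3 + z ^+ 3 + 6%:R * (x * y * z)) ^+ #|F|.-1
  = \sum_(s : F) \sum_(t : F) \sum_(u : F)
     (u ^+ 3 + (2%:R * s ^+ 3 - 3%:R * s ^+ 2 * t - 3%:R * s * t ^+ 2
                + 2%:R * t ^+ 3)) ^+ #|F|.-1.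
Proof.
move=> nz3; pose f (x y z : F) :=
  (x ^+ 3 + y ^+ 3 + z ^+ 3 + 6%:R * (x * y * z)) ^+ #|F|.-1.
(* The factor 3 that the change of variables produces is harmless, as its [(q - 1)]-st power is
   1. *)
have fE x y z : f x y z =
    (3%:R * (x ^+ 3 + y ^+ 3 + z ^+ 3 + 6%:R * (x * y * z))) ^+ #|F|.-1.
  by rewrite exprMn expf_card_pred // mul1r.
have shift (z : F) (g : F -> F) : \sum_x g x = \sum_s g (s + z).
  by apply: reindex; exists (fun x => x - z) => x _; rewrite (addrK, subrK).
rewrite [LHS](eq_bigr (fun x => \sum_z \sum_y f x y z)); last first.
  by move=> x _; rewrite exchange_big.
rewrite exchange_big.
rewrite [LHS](eq_bigr (fun z => \sum_s \sum_t f (s + z) (t + z) z)); last first.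
  by move=> z _; rewrite (shift z); apply: eq_bigr => s _; rewrite (shift z).
rewrite exchange_big; apply: eq_bigr => s _.
rewrite exchange_big; apply: eq_bigr => t _.
rewrite [RHS](reindex (fun z => s + t + 3%:R * z)) /=; last first.
  by exists (fun u => (u - (s + t)) / 3%:R) => z _; field.
apply: eq_bigr => z _; rewrite fE; congr (_ ^+ _); ring.
Qed.

Lemma cube_bij (F : finFieldType) : #|F| = 2 %[mod 3] ->
  bijective (fun x : F => x ^+ 3).
Proof.
move=> card2; apply: injF_bij.
(* With [q = #|F|], this exponent [e] satisfies [3 e = 2 q - 1], and [x ^+ (2 q - 1) = x]. *)
apply: (can_inj (g := fun y => y ^+ (2 * #|F|.-1 %/ 3).+1)) => x.
have /= cardK := card_predK F; have gt0 := card_pred_gt0 F.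
rewrite -exprM (_ : (3 * _)%N = (#|F| + #|F|.-1)%N); last first.
  by rewrite /= in card2 *; rewrite -cardK in card2 *; lia.
by rewrite exprD expf_card -exprS cardK expf_card.
Qed.

(** For fixed [s] and [t], cubing [u] and then adding the binary cubic permutes [F], so the inner
    sum is -1; summing this over [t] gives a multiple of [#|F|]. *)
Lemma sum_hesse_2mod3 (F : finFieldType) :
  3%:R != 0 :> F -> #|F| = 2 %[mod 3] ->
  \sum_(x : F) \sum_(y : F) \sum_(z : F)
     (x ^+ 3 + y ^+ 3 + z ^+ 3 + 6%:R * (x * y * z)) ^+ #|F|.-1 = 0.
Proof.
move=> nz3 card2; rewrite sum_hesse_change // big1 // => s _.
rewrite (eq_bigr (fun=> -1)) => [|t _].
  by rewrite sumr_const mulNrn natr_card oppr0.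
move: (2%:R * s ^+ 3 - _ - _ + _) => c.
rewrite -(reindex (fun u => u ^+ 3) (P := xpredT)
  (F := fun v => (v + c) ^+ _)) /=; last first.
  exact/onW_bij/cube_bij.
rewrite -(reindex (fun u => u + c) (P := xpredT) (F := fun v => v ^+ _)) /=.
  by rewrite sum_expr_card card_pred_gt0 dvdnn.
by exists (fun x => x - c) => x _; rewrite (addrK, subrK).
Qed.

(** The coordinates [s + w t] and [s + w^2 t], with [w^2 = - (w + 1)], turn the binary cubic into a
    sum of two cubes; the change is invertible because [(2 w + 1)^2 = -3] is nonzero. *)
Lemma sum_hesse_1mod3 (F : finFieldType) (w : F) :
  3%:R != 0 :> F -> w ^+ 2 + w + 1 = 0 ->
  \sum_(x : F) \sum_(y : F) \sum_(z : F)
     (x ^+ 3 + y ^+ 3 + z ^+ 3 + 6%:R * (x * y * z)) ^+ #|F|.-1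
  = \sum_(x : F) \sum_(y : F) \sum_(z : F)
     (x ^+ 3 + y ^+ 3 + z ^+ 3 + 0 * (x * y * z)) ^+ #|F|.-1.
Proof.
move=> nz3 w2; rewrite sum_hesse_change // [LHS]pair_big [RHS]pair_big /=.
have nzw : 2%:R * w + 1 != 0.
  apply: contraNneq nz3 => w1.
  have -> : 3%:R = 4%:R * (w ^+ 2 + w + 1) - (2%:R * w + 1) ^+ 2 by ring.
  by rewrite w2 w1 mulr0 expr0n subr0.
rewrite [RHS](reindex (fun v : F * F => (v.1 + w * v.2, v.1 - (w + 1) * v.2))).
  apply: eq_bigr => -[s t] _ /=; apply: eq_bigr => u _; congr (_ ^+ _).
  (* The factor introduced here is the quotient of the difference of the two cubics by
     [w ^+ 2 + w + 1]. *)
  rewrite mul0r addr0 -[LHS]addr0 -(mulr0 (6%:R * s * t ^+ 2 - 3%:R * t ^+ 3)).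
  rewrite -w2; ring.
exists (fun v => ((v.1 * (w + 1) + v.2 * w) / (2%:R * w + 1),
                  (v.1 - v.2) / (2%:R * w + 1))).
  by case=> s t _ /=; congr (_, _); field.
by case=> s t _ /=; congr (_, _); field.
Qed.

(** * Truncated sums of [(3k)! / k!^3] over a prime field *)

Lemma prime_card_pchar (F : finFieldType) : prime #|F| -> #|F| \in [pchar F].
Proof. by move=> pr; rewrite inE pr natr_card eqxx. Qed.

Lemma natf_eq0_card (F : finFieldType) (n : nat) :
  prime #|F| -> (n%:R == 0 :> F) = (#|F| %| n)%N.
Proof. by move=> pr; rewrite (dvdn_pcharf (prime_card_pchar F pr)). Qed.

(** By induction: with [q = #|F|], consecutive binomials add up to ['C(q, k + 1)], a multiple of the
    prime [q]. *)
Lemma bin_card_pred (F : finFieldType) (k : nat) : prime #|F| ->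
  (k < #|F|)%N -> 'C(#|F|.-1, k)%:R = (-1) ^+ k :> F.
Proof.
move=> pr; elim: k => [|k IHk] ltk; first by rewrite bin0.
apply/eqP; rewrite exprS mulN1r -subr_eq0 opprK -IHk ?(ltnW ltk) // -natrD.
by rewrite -binS card_predK natf_eq0_card // prime_dvd_bin.
Qed.

Definition trinom (k : nat) : nat := ('C(3 * k, 2 * k) * 'C(2 * k, k))%N.

Lemma trinom_fact (k : nat) : (trinom k * k`! ^ 3 = (3 * k)`!)%N.
Proof.
rewrite -(@bin_fact (3 * k) (2 * k)) ?leq_mul2r ?orbT //.
rewrite -(@bin_fact (2 * k) k) ?leq_pmull //.
rewrite (_ : 3 * k - 2 * k = k)%N; last lia.
by rewrite (_ : 2 * k - k = k)%N /trinom; [ring | lia].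
Qed.

(** This is the recurrence of the coefficients of F(1/3,2/3;1;27x). *)
Lemma trinom_rec (k : nat) :
  (k.+1 ^ 2 * trinom k.+1 = 3 * (3 * k).+1 * (3 * k).+2 * trinom k)%N.
Proof.
have := trinom_fact k.+1; rewrite (_ : 3 * k.+1 = (3 * k).+3)%N; last lia.
rewrite !factS -trinom_fact; set f := k`! => H.
have pos : (0 < k.+1 * f ^ 3)%N by rewrite muln_gt0 expn_gt0 fact_gt0.
apply/eqP; rewrite -(eqn_pmul2r pos); apply/eqP.
transitivity (trinom k.+1 * (k.+1 * f) ^ 3)%N; first ring.
rewrite H; ring.
Qed.

(** With [q = #|F|], the first binomial is [(-1) ^ l], and [c ^ (q - 1) = 1] turns the remaining
    power of [c] into an inverse; terms with [3 l > q - 1] vanish. *)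
Lemma sum_pencil_prime (F : finFieldType) (c : F) :
  prime #|F| -> 3%:R != 0 :> F -> c != 0 ->
  \sum_(x : F) \sum_(y : F) \sum_(z : F)
     (x ^+ 3 + y ^+ 3 + z ^+ 3 + c * (x * y * z)) ^+ #|F|.-1
  = - \sum_(l < (#|F| %/ 3).+1) (trinom l)%:R * (- (c ^+ 3)^-1) ^+ l.
Proof.
move=> pr nz3 nzc; rewrite sum_cubic_pencil; congr (- _).
have cardK := card_predK F.
have le_q : ((#|F| %/ 3).+1 <= #|F|)%N.
  by rewrite -{2}cardK ltnS; have := card_pred_gt0 F; lia.
rewrite [RHS](big_ord_widen #|F|
  (fun l => (trinom l)%:R * (- (c ^+ 3)^-1) ^+ l)) //.
rewrite [RHS]big_mkcond; apply: eq_bigr => l _; rewrite ltnS leq_divRL //.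
have [le_l|lt_l] := leqP (l * 3) #|F|; last first.
  by rewrite bin_small ?mul0r // mulnC; lia.
(* Equality would force [#|F| = 3]. *)
have lt_l : (l * 3 < #|F|)%N.
  rewrite ltn_neqAle le_l andbT; apply: contraNneq nz3 => cardE.
  have /eqP -> : 3%N == #|F| by rewrite -dvdn_prime2 // -cardE dvdn_mull.
  by rewrite natr_card.
have nzcl : c ^+ (3 * l) != 0 by rewrite expf_neq0.
have -> : c ^+ (#|F|.-1 - 3 * l) = (c ^+ (3 * l))^-1.
  apply: (mulIf nzcl); rewrite -exprD subnK ?expf_card_pred ?mulVf //.
  by rewrite -ltnS cardK mulnC.
rewrite bin_card_pred; [|by []|by rewrite mulnC].
rewrite exprM (_ : (-1) ^+ 3 = -1); last ring.
by rewrite -[in RHS]mulN1r exprMn exprVn -exprM natrM; ring.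
Qed.

Lemma hesse_sum_2mod3 (F : finFieldType) :
  prime #|F| -> 3%:R != 0 :> F -> 2%:R != 0 :> F -> #|F| = 2 %[mod 3] ->
  \sum_(l < (#|F| %/ 3).+1) (trinom l)%:R * (- 216%:R^-1) ^+ l = 0 :> F.
Proof.
move=> pr nz3 nz2 card2; have nz6 : 6%:R != 0 :> F.
  by rewrite (_ : 6%:R = 2%:R * 3%:R) ?mulf_neq0 //; ring.
have := sum_hesse_2mod3 F nz3 card2.
rewrite sum_pencil_prime // => /eqP; rewrite oppr_eq0 => /eqP sum0.
rewrite -[RHS]sum0; apply: eq_bigr => l _.
by congr (_ * (- _^-1) ^+ _); ring.
Qed.

(** The pencil member [c = 6] may be replaced by [c = 0], where only the term [3 l = q - 1]
    survives. Its further factor ['C(3 n, n)] is [(-1)^n], and [n] is even because [q] is odd. *)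
Lemma hesse_sum_1mod3 (F : finFieldType) (w : F) :
  prime #|F| -> 3%:R != 0 :> F -> 2%:R != 0 :> F -> #|F| = 1 %[mod 3] ->
  w ^+ 2 + w + 1 = 0 ->
  \sum_(l < (#|F| %/ 3).+1) (trinom l)%:R * (- 216%:R^-1) ^+ l
    = 'C(2 * (#|F| %/ 3), #|F| %/ 3)%:R :> F.
Proof.
move=> pr nz3 nz2 card1 w2; have nz6 : 6%:R != 0 :> F.
  by rewrite (_ : 6%:R = 2%:R * 3%:R) ?mulf_neq0 //; ring.
transitivity (\sum_(l < (#|F| %/ 3).+1) (trinom l)%:R
                * (- (6%:R ^+ 3)^-1) ^+ l : F).
  by apply: eq_bigr => l _; congr (_ * (- _^-1) ^+ _); ring.
apply/oppr_inj; rewrite -sum_pencil_prime // (sum_hesse_1mod3 F w) //.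
rewrite sum_cubic_pencil; congr (- _).
set n := (#|F| %/ 3)%N.
have cardE : #|F| = (3 * n).+1.
  by rewrite /n; move: card1; rewrite /=; lia.
have lt_n : (n < #|F|)%N by rewrite cardE; lia.
rewrite (bigD1 (Ordinal lt_n)) //= big1 => [|l].
  rewrite {1 2}cardE /= subnn expr0 mulr1 addr0 binn mul1r.
  rewrite -bin_sub; last lia.
  rewrite (_ : 3 * n - 2 * n = n)%N; last lia.
  have even_n : ~~ odd n.
    apply: contraNN nz2 => odd_n.
    have /eqP -> : 2%N == #|F|.
      by rewrite -dvdn_prime2 // dvdn2 cardE /= oddM odd_n.
    by rewrite natr_card.
  rewrite (_ : 3 * n = #|F|.-1)%N; last by rewrite cardE.
  by rewrite bin_card_pred // -signr_odd (negPf even_n) mul1r.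
rewrite -val_eqE /= (_ : #|F|.-1 = 3 * n)%N ?cardE // => nl.
rewrite expr0n subn_eq0 leq_pmul2l //.
case: (ltngtP l n) nl => // [ltl|ltl] _; rewrite ?mulr0 //.
(* For [l > n] the exponent of 0 is a truncated difference, so that power is 1 and it is the
   binomial that vanishes. *)
by rewrite bin_small ?mul0r // ltn_pmul2l.
Qed.

(** * Hypergeometric equations and the quadratic transformation *)

(* [d] times the hypergeometric operator with [c = 1], [a + b + 1 = e / d] and
   [a b = f / d]. *)
Definition hypergeom_op (R : comNzRingType) (d e f : nat) (y : {poly R}) :=
  (y^`()^`() * 'X - y^`()^`() * 'X * 'X + y^`()) *+ d
    - y^`() * 'X *+ e - y *+ f.

Lemma coef_hypergeom_op (R : comNzRingType) (d e f : nat) (y : {poly R}) k :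
  (hypergeom_op R d e f y)`_k
    = d%:R * k.+1%:R ^+ 2 * y`_k.+1
      - (d%:R * k%:R * (k%:R - 1) + e%:R * k%:R + f%:R) * y`_k.
Proof.
rewrite /hypergeom_op !(coefB, coefMn, coefD, coefMX, coef_deriv).
case: k => [|[|k]] /=; rewrite ?coef_deriv; ring.
Qed.

(* F(1/3,1/6;1;4x(1-x)) = F(1/3,2/3;1;x) *)
Lemma hypergeom_op_comp1 (R : comNzRingType) (q : {poly R}) :
  hypergeom_op R 18 27 1 q = 0 ->
  hypergeom_op R 9 18 2 (q \Po (('X - 'X ^+ 2) *+ 4)) = 0.
Proof.
set u := (_ *+ 4) => /(congr1 (comp_poly u)).
have du : u^`() = (1 - 'X *+ 2) *+ 4.
  by rewrite /u derivMn derivB derivX derivXn expr1.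
have ddu : u^`()^`() = - 8%:R.
  by rewrite du derivMn derivB derivMn derivX derivC; ring.
rewrite /hypergeom_op !comp_polyB !raddfMn /= comp_polyD comp_polyB !comp_polyM.
rewrite comp_polyX comp_poly0.
rewrite !deriv_comp !derivM ddu !deriv_comp du.
move: (_ \Po u) (_ \Po u) (_ \Po u) => A B C.
rewrite /u => E; rewrite -(mulr0 2%:R) -E; ring.
Qed.

(* (1-2x) F(2/3,5/6;1;4x(1-x)) = F(1/3,2/3;1;x) *)
Lemma hypergeom_op_comp2 (R : comNzRingType) (q : {poly R}) :
  hypergeom_op R 18 45 10 q = 0 ->
  hypergeom_op R 9 18 2 ((1 - 'X *+ 2) * (q \Po (('X - 'X ^+ 2) *+ 4))) = 0.
Proof.
have [r rE] : exists r : {poly R}, r = 1 - 'X *+ 2 by exists (1 - 'X *+ 2).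
rewrite -rE; set u := (_ *+ 4) => /(congr1 (comp_poly u)).
have du : u^`() = r *+ 4.
  by rewrite /u derivMn derivB derivX derivXn expr1 rE.
have dr : r^`() = - 2%:R.
  by rewrite rE derivB derivMn derivX derivC sub0r.
have d2 : (- 2%:R : {poly R})^`() = 0.
  by rewrite derivN -polyC_natr derivC oppr0.
rewrite /hypergeom_op !comp_polyB !raddfMn /= comp_polyD comp_polyB !comp_polyM.
rewrite comp_polyX comp_poly0.
rewrite !(dr, d2, du, derivM, derivMn, derivD, deriv_comp) mul0r add0r.
move: (_ \Po u) (_ \Po u) (_ \Po u) => A B C.
rewrite /u rE => E; rewrite -(mulr0 (2%:R * (1 - 'X *+ 2))) -E; ring.
Qed.

(** The differential equation and [trinom_rec] give the same recurrence up to the scaling by 27; it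
    determines the coefficients as long as [k + 1] is invertible, that is, below [#|F|]. *)
Lemma hypergeom_coef_trinom (F : finFieldType) (y : {poly F}) (k : nat) :
  prime #|F| -> hypergeom_op F 9 18 2 y = 0 -> y`_0 = 1 -> (k < #|F|)%N ->
  27%:R ^+ k * y`_k = (trinom k)%:R.
Proof.
move=> pr ode y0; elim: k => [|k IHk] ltk.
  by rewrite y0 mulr1 /trinom !bin0.
have nzk : k.+1%:R != 0 :> F by rewrite natf_eq0_card // gtnNdvd.
have := congr1 (fun q : {poly F} => q`_k) ode.
rewrite coef_hypergeom_op coef0 => /eqP; rewrite subr_eq0 => /eqP recy.
apply: (mulfI (expf_neq0 2 nzk)); rewrite -!(natrX _ k.+1) -natrM trinom_rec.
have -> : (k.+1 ^ 2)%:R * (27%:R ^+ k.+1 * y`_k.+1)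
    = 3%:R * 27%:R ^+ k * (9%:R * k.+1%:R ^+ 2 * y`_k.+1) :> F.
  by rewrite natrX (exprS 27%:R); ring.
rewrite recy natrM -IHk ?(ltnW ltk) // !natrM -[in (3 * k).+2%:R]natr1.
rewrite -[in (3 * k).+1%:R]natr1 natrM; ring.
Qed.

(** This is the terminating series F(-n,-m;1;X). *)
Definition binom2_poly (R : comNzRingType) (n m : nat) : {poly R} :=
  \poly_(k < m.+1) ('C(n, k) * 'C(m, k))%:R.

Lemma coef_binom2_poly (R : comNzRingType) (n m k : nat) :
  (binom2_poly R n m)`_k = ('C(n, k) * 'C(m, k))%:R.
Proof.
by rewrite coef_poly ltnS; case: leqP => // ltmk; rewrite (@bin_small m) ?muln0.
Qed.

Lemma binom2_poly_rec (R : comNzRingType) (n m k : nat) :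
  k.+1%:R ^+ 2 * (binom2_poly R n m)`_k.+1
    = (n%:R - k%:R) * (m%:R - k%:R) * (binom2_poly R n m)`_k.
Proof.
have binE j : k.+1%:R * 'C(j, k.+1)%:R = (j%:R - k%:R) * 'C(j, k)%:R :> R.
  rewrite -natrM mul_bin_left natrM; case: (leqP k j) => [le|lt].
    by rewrite natrB.
  by rewrite (bin_small lt) !mulr0.
rewrite !coef_binom2_poly !natrM.
transitivity (k.+1%:R * 'C(n, k.+1)%:R * (k.+1%:R * 'C(m, k.+1)%:R) : R).
  by ring.
by rewrite !binE; ring.
Qed.

(** The hypothesis identifies [(n - k)(m - k)] with [(k + a)(k + b)] in [R], up to the factor [d],
    so that [n] and [m] can stand for [- a] and [- b] modulo a prime. *)
Lemma hypergeom_binom2 (R : comNzRingType) (n m d e f : nat) :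
  (forall k : nat, d%:R * ((n%:R - k%:R) * (m%:R - k%:R))
     = d%:R * k%:R * (k%:R - 1) + e%:R * k%:R + f%:R :> R) ->
  hypergeom_op R d e f (binom2_poly R n m) = 0.
Proof.
move=> rec; apply/polyP => k; rewrite coef_hypergeom_op coef0 -mulrA.
rewrite binom2_poly_rec -rec; ring.
Qed.

Lemma coprime6_div (q : nat) : ~~ (2 %| q)%N -> ~~ (3 %| q)%N ->
  if (q %% 3 == 1)%N then q = (6 * (q %/ 6)).+1 /\ (q %/ 3 = 2 * (q %/ 6))%N
  else q = (6 * (q %/ 6) + 5)%N /\ (q %/ 3 = (2 * (q %/ 6)).+1)%N.
Proof. by move=> q2 q3; case: eqP => q1; lia. Qed.

Lemma size_poly_X_X2 (R : nzRingType) :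
  (size (('X - 'X ^+ 2 : {poly R}) *+ 4) <= 3)%N.
Proof.
apply/leq_sizeP => j lt3; rewrite coefMn coefB coefX coefXn.
by rewrite !gtn_eqF ?subrr ?mul0rn // ltnW.
Qed.

(** The composed polynomial has constant term 1, solves the equation of F(1/3,2/3;1;x), and has
    degree at most [n]: [2 m] when [n = 2 m], and [2 m + 1], with the extra linear factor, when
    [n = 2 m + 1]. So its coefficients are those of the truncated series, and evaluation at
    [x = -1/8] gives both sides. *)
Lemma horner_binom2_trinom (F : finFieldType) :
  prime #|F| -> 3%:R != 0 :> F -> 2%:R != 0 :> F ->
  (if (#|F| %% 3 == 1)%N then 1 else 5%:R / 4%:R)
    * (binom2_poly F (#|F| %/ 3) (#|F| %/ 6)).[- (9%:R / 16%:R)]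
  = \sum_(l < (#|F| %/ 3).+1) (trinom l)%:R * (- 216%:R^-1) ^+ l.
Proof.
move=> pr nz3 nz2; set n := (#|F| %/ 3)%N; set m := (#|F| %/ 6)%N.
set q := binom2_poly F n m.
pose u : {poly F} := ('X - 'X ^+ 2) *+ 4.
pose r : {poly F} := 1 - 'X *+ 2.
have nz i j : (2 ^ i * 3 ^ j)%:R != 0 :> F.
  by rewrite natrM !natrX mulf_neq0 ?expf_neq0.
have nz4 : 4%:R != 0 :> F := nz 2 0.
have nz8 : 8%:R != 0 :> F := nz 3 0.
have nz16 : 16%:R != 0 :> F := nz 4 0.
have nz27 : 27%:R != 0 :> F := nz 0 3.
have nz216 : 216%:R != 0 :> F := nz 3 3.
have evalu : u.[- 8%:R^-1] = - (9%:R / 16%:R).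
  by rewrite /u hornerMn !hornerE; field; rewrite ?nz4 ?nz8 ?nz16 ?nz27 ?nz216.
have u0 : u.[0] = 0 by rewrite /u hornerMn !hornerE; ring.
have evalr : r.[- 8%:R^-1] = 5%:R / 4%:R.
  by rewrite /r !hornerE; field; rewrite ?nz4 ?nz8 ?nz16 ?nz27 ?nz216.
have q0 : q`_0 = 1 by rewrite coef_binom2_poly !bin0.
have size_qu : (size (q \Po u) <= (2 * m).+1)%N.
  apply: leq_trans (size_comp_poly_leq _ _) _.
  rewrite ltnS mulnC leq_mul // -subn1 leq_subLR ?size_poly_X_X2 //.
  exact: size_poly.
have ltn : (n.+1 <= #|F|)%N.
  by rewrite ltn_Pdiv ?prime_gt0.
have eval (y : {poly F}) : hypergeom_op F 9 18 2 y = 0 -> y.[0] = 1 ->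
    (size y <= n.+1)%N ->
    y.[- 8%:R^-1] = \sum_(l < n.+1) (trinom l)%:R * (- 216%:R^-1) ^+ l.
  rewrite horner_coef0 => ode y0 size_y; rewrite (horner_coef_wide _ size_y).
  apply: eq_bigr => l _.
  rewrite -(hypergeom_coef_trinom F y) ?(leq_trans _ ltn) //.
  (* The scaling by 27 matches because [27 / 216 = 1 / 8]. *)
  rewrite mulrAC -exprMn mulrC; congr (_ ^+ _ * _).
  by field; rewrite ?nz4 ?nz8 ?nz16 ?nz27 ?nz216.
have cardF : #|F|%:R = 0 :> F := natr_card F.
have ndvd (l : nat) : prime l -> l%:R != 0 :> F -> ~~ (l %| #|F|)%N.
  move=> prl; apply: contra; rewrite dvdn_prime2 // => /eqP ->.
  by rewrite cardF.
have := coprime6_div _ (ndvd 2%N isT nz2) (ndvd 3%N isT nz3).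
rewrite -/n -/m; case: eqP => _ [cardE nE].
  rewrite mul1r -(eval (q \Po u)).
  - by rewrite horner_comp evalu.
  (* Since [6 m + 1 = #|F|] is 0 in [F], [m] is -1/6 and [n = 2 m] is -1/3. *)
  - apply/hypergeom_op_comp1/hypergeom_binom2 => k; rewrite nE natrM.
    have : 6%:R * m%:R + 1 = 0 :> F.
      by rewrite -cardF cardE -[in RHS]natr1 natrM.
    move=> m6; apply/eqP; rewrite -subr_eq0; apply/eqP.
    rewrite -(mulr0 (6%:R * m%:R - 1 - 9%:R * k%:R)) -m6; ring.
  - by rewrite horner_comp u0 horner_coef0.
  - by rewrite nE.
rewrite -evalr -(eval (r * (q \Po u))).
- by rewrite -evalu -horner_comp hornerM.
(* Here [6 m + 5 = 0] in [F], so [m] is -5/6 and [n = 2 m + 1] is -2/3. *)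
- apply/hypergeom_op_comp2/hypergeom_binom2 => k.
  rewrite nE -[in (2 * m).+1%:R]natr1 natrM.
  have : 6%:R * m%:R + 5%:R = 0 :> F by rewrite -cardF cardE [RHS]natrD natrM.
  move=> m6; apply/eqP; rewrite -subr_eq0; apply/eqP.
  rewrite -(mulr0 (6%:R * m%:R - 2%:R - 9%:R * k%:R)) -m6; ring.
- by rewrite hornerM horner_comp u0 (horner_coef0 q) q0 /r !hornerE; ring.
- rewrite nE; apply: leq_trans (size_polyMleq _ _) _.
  have size_r : (size r <= 2)%N.
    apply/leq_sizeP => j lt2; rewrite coefB coef1 coefMn coefX.
    by rewrite !gtn_eqF ?mul0rn ?subrr // ltnW.
  rewrite -subn1 leq_subLR add1n -(add2n (2 * m)) -addnS.
  exact: leq_add size_r size_qu.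
Qed.

(** * The Jacobi sum of a cubic character *)

Lemma card_unity_roots (F : finFieldType) (n : nat) :
  (n %| #|F|.-1)%N -> #|[pred z : F | z ^+ n == 1]| = n.
Proof.
move=> dvd_n; have [g prim_g] := primitive_root_card F.
have prim_h := dvdn_prim_root prim_g dvd_n.
set h := g ^+ _ in prim_h.
have inj_h : injective (fun i : 'I_n => h ^+ i).
  move=> i j /eqP; rewrite (eq_prim_root_expr prim_h) !modn_small //.
  by move/eqP/val_inj.
rewrite -[RHS]card_ord -(card_codom inj_h); apply: eq_card => z.
rewrite inE; apply/eqP/codomP => [zn1|[i ->]].
  by have [i ->] := prim_rootP prim_h zn1; exists i.
by rewrite -exprM mulnC exprM (prim_expr_order prim_h) expr1n.
Qed.

(** A finite-field beta integral: after expanding [(1 - x) ^+ b], the bounds on [a] and [b] leave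
    [a + i = q - 1] as the only exponent with a nonzero power sum. *)
Lemma sum_expr_mul_compl (F : finFieldType) (a b : nat) :
  (0 < a <= #|F|.-1)%N -> (a + b < 2 * #|F|.-1)%N ->
  \sum_(x : F) x ^+ a * (1 - x) ^+ b
    = - ((-1) ^+ (#|F|.-1 - a) * 'C(b, #|F|.-1 - a)%:R).
Proof.
set N := #|F|.-1 => /andP[a_gt0 leaN] ltabN.
(* The range is padded so that it contains the index [N - a] even when this exceeds [b]. *)
have lt_b : (b < (b + N).+1)%N by rewrite ltnS leq_addr.
transitivity (\sum_(x : F) \sum_(i < (b + N).+1)
    (-1) ^+ i * 'C(b, i)%:R * x ^+ (a + i)).
  apply: eq_bigr => x _; rewrite (exprDn_wide _ _ _ _ _ lt_b) mulr_sumr.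
  by apply: eq_bigr => i _; rewrite expr1n (exprNn x) exprD; ring.
have lt_Na : (N - a < (b + N).+1)%N by lia.
rewrite exchange_big (bigD1 (Ordinal lt_Na)) //= [X in _ + X]big1 => [|i].
  rewrite -mulr_sumr sum_expr_card -/N subnKC // dvdnn.
  by rewrite /N card_pred_gt0 /=; ring.
rewrite -val_eqE /= => ni; rewrite -mulr_sumr sum_expr_card -/N.
have [lt_bi|le_ib] := ltnP b i; first by rewrite bin_small ?mulr0 ?mul0r.
case: (boolP (N %| _)%N) => [/dvdnP[c Ec]|_]; last by rewrite andbF oppr0 mulr0.
case: c Ec => [|[|c]] Ec; last by rewrite !mulSn in Ec; lia.
  by rewrite mul0n in Ec; lia.
by case/eqP: ni; rewrite mul1n in Ec; lia.
Qed.

(* The level sets of the cubic residue symbol of [x (1 - x)]; their cardinals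
   at [1], [w], [w^2] are the coefficients of the Jacobi sum of that symbol. *)
Definition cubic_fibre (F : finFieldType) (c : F) : pred F :=
  [pred x | (x * (1 - x)) ^+ (#|F|.-1 %/ 3) == c].

Lemma mul_compl_neq0 (F : fieldType) (x : F) :
  (x * (1 - x) != 0) = (x != 0) && (x != 1).
Proof. by rewrite mulf_eq0 subr_eq0 negb_or (eq_sym 1). Qed.

Lemma card_mul_compl_neq0 (F : finFieldType) :
  #|[pred y : F | y * (1 - y) != 0]| = (#|F| - 2)%N.
Proof.
have := cardC (pred2 (0 : F) 1); rewrite card2 eq_sym oner_neq0 => <-.
rewrite addKn; apply: eq_card => y.
by rewrite !inE mul_compl_neq0 negb_or.
Qed.

(* [x |-> 1 / (1 - x)] has order 3 and preserves [x (1 - x)] up to cubes. *)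
Lemma dvdn3_cubic_fibre (F : finFieldType) (c : F) :
  (3 %| #|F|.-1)%N -> c != 0 -> c != 1 -> (3 %| #|cubic_fibre F c|)%N.
Proof.
move=> dvd3 nz_c n1_c; pose f (x : F) := (1 - x)^-1.
set n := (#|F|.-1 %/ 3)%N.
have n3 : (n * 3)%N = #|F|.-1 by rewrite divnK.
have n_gt0 : (0 < n)%N by have := card_pred_gt0 F; rewrite -n3; case: (n).
have inj_f : injective f by move=> x y /invr_inj /addrI /oppr_inj.
have fibreN x : x \in cubic_fibre F c ->
    [/\ x != 0, 1 - x != 0 & x * (1 - x) != 1].
  rewrite inE -/n => xc.
  have : x * (1 - x) != 0.
    by apply: contraNneq nz_c => x0; rewrite -(eqP xc) x0 expr0n gtn_eqF.
  rewrite mulf_eq0 negb_or => /andP[x0 x1]; split => //.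
  by apply: contraNneq n1_c => x0'; rewrite -(eqP xc) x0' expr1n.
have n_even : (-1) ^+ n = 1 :> F.
  have <- : (-1) ^+ 3 = -1 :> F by ring.
  by rewrite -exprM mulnC n3 expf_card_pred // oppr_eq0 oner_eq0.
have stable x : x \in cubic_fibre F c -> f x \in cubic_fibre F c.
  move=> xc; have [x0 x1 _] := fibreN x xc.
  move: xc; rewrite !inE -/n => /eqP <-.
  have -> : f x * (1 - f x) = - (x * (1 - x)) * ((1 - x)^-1 ^+ 3).
    by rewrite /f; field.
  rewrite exprMn -exprM mulnC n3 expf_card_pred ?invr_eq0 // mulr1.
  by rewrite exprNn n_even mul1r.
have f3 x : x \in cubic_fibre F c -> f (f (f x)) = x.
  move=> xc; have [x0 x1 _] := fibreN x xc.
  rewrite /f (_ : 1 - (1 - x)^-1 = - x / (1 - x)); last by field.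
  rewrite invf_div (_ : 1 - (1 - x) / - x = x^-1) ?invrK //; field.
  by rewrite x0 oppr_eq0.
apply/dvdnP; exists (fcard f (cubic_fibre F c)); symmetry.
apply: fcard_order_set => //.
  apply/subsetP => x xc; rewrite inE; have [x0 x1 xx] := fibreN x xc.
  (* A fixed point would satisfy [x * (1 - x) = 1], which lies over 1 rather than [c]. *)
  have fx_neq : x != f x.
    by apply: contraNneq xx => {1}->; rewrite /f mulVf.
  have cyc : fcycle f [:: x; f x; f (f x)] by rewrite /= f3 ?eqxx.
  have uni : uniq [:: x; f x; f (f x)].
    rewrite /= !inE negb_or fx_neq (inj_eq inj_f) fx_neq !andbT /=.
    by apply: contraNneq fx_neq => E; rewrite {2}E f3.
  by rewrite (order_cycle cyc uni) ?inE ?eqxx.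
move=> x _ /eqP <-; apply/idP/idP => [/stable //|fxc].
by rewrite -(inj_f _ _ (f3 _ fxc)); apply/stable/stable.
Qed.

(* The count behind |J|^2 = q for the Jacobi sum J: substituting [x = t y] and
   then [z = (1 - t y) / (1 - y)] makes each inner count that of the [z] with
   [t z] a nonzero cube, with [z = 1] and [z = t] removed. *)
Lemma cubic_fibre_pairs (F : finFieldType) (n : nat) : #|F| = (3 * n).+1 ->
  (\sum_(y : F | (y * (1 - y) != 0)%R)
     #|cubic_fibre F ((y * (1 - y)) ^+ n)%R| = 3 * n ^ 2 + 1)%N.
Proof.
move=> cardE; have n_gt0 : (0 < n)%N.
  by have := finNzRing_gt1 F; rewrite cardE ltnS muln_gt0.
have N3 : #|F|.-1 = (3 * n)%N by rewrite cardE.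
have nE : (#|F|.-1 %/ 3)%N = n by rewrite N3 mulKn.
have zero_n : 0 ^+ n = 0 :> F by rewrite expr0n gtn_eqF.
(* For [y] other than 0 and 1, [B t y] records whether [t * y] lies in the same level set as [y]. *)
pose B (t y : F) : nat := (t * (1 - t * y) / (1 - y)) ^+ n == 1.
have fibreE y : y * (1 - y) != 0 ->
    #|cubic_fibre F ((y * (1 - y)) ^+ n)| = (\sum_t B t y)%N.
  move=> yy; have := yy; rewrite mulf_eq0 negb_or => /andP[y0 y1].
  rewrite -sum1_card big_mkcond /= (reindex (fun t => t * y)) /=; last first.
    by exists (fun x => x / y) => x _; rewrite (mulfK, mulfVK).
  apply: eq_bigr => t _; rewrite /B !inE nE; congr (nat_of_bool _).
  have -> : t * y * (1 - t * y) = (t * (1 - t * y) / (1 - y)) * (y * (1 - y)).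
    by field.
  have nzK := expf_neq0 n yy; rewrite exprMn; apply/eqP/eqP => [|->].
    by move/(canRL (mulfK nzK)); rewrite divff.
  by rewrite mul1r.
rewrite (eq_bigr _ fibreE) exchange_big /=.
have card_roots : #|[pred z : F | z ^+ n == 1]| = n.
  by rewrite card_unity_roots // N3 dvdn_mull.
have P01 := @mul_compl_neq0 F.
have card01 : #|[pred y : F | y * (1 - y) != 0]| = (3 * n - 1)%N.
  by rewrite card_mul_compl_neq0 cardE subSS.
have B0 : (\sum_(y : F | (y * (1 - y) != 0)%R) B 0%R y = 0)%N.
  by rewrite big1 // => y _; rewrite /B !mul0r zero_n eq_sym oner_eq0.
have B1 : (\sum_(y : F | (y * (1 - y) != 0)%R) B 1%R y = 3 * n - 1)%N.
  rewrite -card01 -sum1_card; apply: eq_bigr => y.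
  rewrite P01 => /andP[_ y1].
  by rewrite /B !mul1r divff ?expr1n ?eqxx // subr_eq0 eq_sym.
have Bt t : t * (1 - t) != 0 ->
    (\sum_(y : F | (y * (1 - y) != 0)%R) B t y + 2 * (t ^+ n == 1)%R = n)%N.
  rewrite P01 => /andP[t0 t1].
  have t3 : t ^+ (3 * n) = 1 by rewrite -N3 expf_card_pred.
  have sum_n : (\sum_z ((t * z) ^+ n == 1)%R)%N = n.
    rewrite -[RHS]card_roots -sum1_card [RHS]big_mkcond /=.
    rewrite [RHS](reindex (fun z => t * z)) /=; last first.
      by exists (fun z => t^-1 * z) => z _ /=; rewrite ?mulKf ?mulVKf.
    by apply: eq_bigr => z _; rewrite inE; case: eqP.
  rewrite -[RHS]sum_n [RHS](bigD1 t) //= [in RHS](bigD1 1) /=; last first.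
    by rewrite eq_sym.
  rewrite mulr1.
  (* The removed values [z = t] and [z = 1] contribute equally, because [t ^+ (3 * n) = 1]. *)
  have -> : ((t * t) ^+ n == 1) = (t ^+ n == 1).
    apply/eqP/eqP => [t2|tn]; last by rewrite exprMn tn mulr1.
    have : t ^+ (3 * n) = (t * t) ^+ n * t ^+ n.
      by rewrite -exprMn exprM; congr (_ ^+ _); ring.
    by rewrite t3 t2 mul1r.
  rewrite addnA addnn -mul2n addnC; congr (_ + _)%N.
  have t1' : 1 - t != 0 by rewrite subr_eq0 eq_sym.
  pose h y := (1 - t * y) / (1 - y); pose h' z := (z - 1) / (z - t).
  rewrite [RHS](reindex_onto h h') => [|z /andP[zt z1]]; last first.
    have zt' : z - t != 0 by rewrite subr_eq0.
    rewrite /h (_ : 1 - t * h' z = z * (1 - t) / (z - t)); last first.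
      by rewrite /h'; field.
    rewrite (_ : 1 - h' z = (1 - t) / (z - t)); first by field; rewrite zt'.
    by rewrite /h'; field.
  apply: eq_big => [y|y _]; last by rewrite /B /h mulrA.
  rewrite P01; have [->|y1] := eqVneq y 1.
    rewrite andbF; symmetry; apply/negbTE; rewrite !negb_and; apply/orP; right.
    (* [h 1 = 0] since [x / 0 = 0], but [h' 0 = 1 / t] is not 1. *)
    rewrite /h subrr invr0 mulr0 /h' !sub0r invrN mulrNN mul1r.
    by apply: contra t1 => /eqP t1; rewrite -[t]invrK t1 invr1.
  have y1' : 1 - y != 0 by rewrite subr_eq0 eq_sym.
  have ht : h y - t = (1 - t) / (1 - y) by rewrite /h; field.
  have h1 : h y - 1 = (1 - t) * y / (1 - y) by rewrite /h; field.
  rewrite andbT -(subr_eq0 (h y) t) -(subr_eq0 (h y) 1) /h' ht h1.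
  rewrite !mulf_eq0 invr_eq0 (negPf t1') (negPf y1') /= orbF.
  have [//|y0] := eqVneq y 0; apply/esym/eqP; field.
  by rewrite y1'.
have sumt : (\sum_(t : F | (t * (1 - t) != 0)%R) (t ^+ n == 1)%R = n - 1)%N.
  have sum_n : (\sum_(t : F) (t ^+ n == 1)%R)%N = n.
    rewrite -[RHS]card_roots -sum1_card [RHS]big_mkcond /=.
    by apply: eq_bigr => z _; rewrite inE; case: eqP.
  rewrite -[in RHS]sum_n [in RHS](bigD1 0) //= [in RHS](bigD1 1) ?oner_neq0 //=.
  rewrite zero_n expr1n eqxx eq_sym oner_eq0 add0n addKn.
  by apply: eq_bigl => t; rewrite P01.
have sumBt : (\sum_(t : F | (t * (1 - t) != 0)%R)
      \sum_(y : F | (y * (1 - y) != 0)%R) B t y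
    + 2 * (n - 1) = (3 * n - 1) * n)%N.
  rewrite -sumt big_distrr -big_split /= (eq_bigr _ Bt) sum_nat_const.
  by rewrite -card01; congr (_ * _)%N; apply: eq_card.
(* [t = 0] contributes nothing, [t = 1] contributes [3 n - 1], and the other [t] contribute
   [(3 n - 1) n - 2 (n - 1)]. *)
rewrite (bigD1 0) //= B0 (bigD1 1) ?oner_neq0 //= B1.
rewrite (eq_bigl (fun t => t * (1 - t) != 0)) => [|t]; last by rewrite P01.
rewrite add0n.
move: sumBt; set S := bigop _ _ _; nia.
Qed.

Lemma cube_root_neq (F : finFieldType) (n : nat) (w : F) :
  #|F| = (3 * n).+1 -> w ^+ 2 + w + 1 = 0 ->
  [/\ w != 0, w != 1, w ^+ 2 != 1 & w ^+ 2 != w].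
Proof.
move=> cardE w2; have nz3 : 3%:R != 0 :> F.
  apply/eqP => z3; have := natr_card F; rewrite cardE -[in LHS]natr1 natrM z3.
  by rewrite mul0r add0r => /eqP; rewrite oner_eq0.
have w0 : w != 0.
  by apply: contra_eq_neq w2 => ->; rewrite expr0n /= !add0r oner_neq0.
have w1 : w != 1.
  by apply: contraNneq nz3 => w1; rewrite -w2 w1; apply/eqP; ring.
split=> //.
  rewrite sqrf_eq1 (negPf w1) /=; apply: contra_eq_neq w2 => ->.
  by rewrite sqrrN expr1n subrr add0r oner_neq0.
by rewrite expr2 -subr_eq0 -[X in _ - X]mulr1 -mulrBr mulf_neq0 // subr_eq0.
Qed.

(** The argument of [f] is a cube root of unity, hence 1, [w] or [w ^+ 2]. The target [V] is general
    because both cardinals and elements of [F] are summed this way. *)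
Lemma sum_cubic_fibre (F : finFieldType) (V : nmodType) (n : nat) (w : F)
    (f : F -> V) :
  #|F| = (3 * n).+1 -> w ^+ 2 + w + 1 = 0 ->
  \sum_(y : F | y * (1 - y) != 0) f ((y * (1 - y)) ^+ n)
  = f 1 *+ #|cubic_fibre F 1| + f w *+ #|cubic_fibre F w|
    + f (w ^+ 2) *+ #|cubic_fibre F (w ^+ 2)|.
Proof.
move=> cardE w2; have n_gt0 : (0 < n)%N.
  by have := finNzRing_gt1 F; rewrite cardE ltnS muln_gt0.
have N3 : #|F|.-1 = (3 * n)%N by rewrite cardE.
have nE : (#|F|.-1 %/ 3)%N = n by rewrite N3 mulKn.
have [nz_w w1 w21 w2w] := cube_root_neq F n w cardE w2.
have fibre_sum c : c != 0 -> f c *+ #|cubic_fibre F c| =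
    \sum_(y : F | y * (1 - y) != 0)
      (if (y * (1 - y)) ^+ n == c then f c else 0).
  move=> nz_c; rewrite -big_mkcondr -sumr_const; apply: eq_bigl => y.
  rewrite inE nE; case: eqP => [yc|_]; last by rewrite andbF.
  rewrite andbT; symmetry; apply: contraNneq nz_c => y0.
  by rewrite -yc y0 expr0n gtn_eqF.
rewrite !fibre_sum ?oner_neq0 ?expf_neq0 // -!big_split /=.
apply: eq_bigr => y yy; set v := _ ^+ n.
have : (v - 1) * ((v - w) * (v - w ^+ 2)) = 0.
  have : v ^+ 3 = 1 by rewrite /v -exprM mulnC -N3 expf_card_pred.
  move=> v3.
  transitivity (v ^+ 3 - 1 + (v - 1) * (w - 1 - v) * (w ^+ 2 + w + 1)).
    by ring.
  by rewrite w2 v3 mulr0 addr0 subrr.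
move/eqP; rewrite !mulf_eq0 !subr_eq0 => /or3P[] /eqP ->; rewrite !eqxx.
- by rewrite ![1 == _]eq_sym (negPf w1) (negPf w21) !addr0.
- by rewrite (negPf w1) [w == _]eq_sym (negPf w2w) add0r addr0.
- by rewrite (negPf w21) (negPf w2w) !add0r.
Qed.

(** Let [N0], [N1 = 3 B1], [N2 = 3 B2] be the fibre cardinals over 1, [w], [w^2]. Their total
    [3 n - 1] and sum of squares [3 n^2 + 1] give the norm equation, the total modulo 3 gives the
    residue of [L], and the beta sums in [F] give the binomial. *)
Lemma jacobi_binomial (F : finFieldType) (n : nat) (w : F) :
  #|F| = (3 * n).+1 -> w ^+ 2 + w + 1 = 0 ->
  exists L M : int,
    [/\ 4%:Z * #|F|%:Z = L ^+ 2 + 27%:Z * M ^+ 2, (3 %| L - 2)%Z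
      & L%:~R = 'C(2 * n, n)%:R :> F].
Proof.
move=> cardE w2; have n_gt0 : (0 < n)%N.
  by have := finNzRing_gt1 F; rewrite cardE ltnS muln_gt0.
have N3 : #|F|.-1 = (3 * n)%N by rewrite cardE.
have [nz_w w1 w21 w2w] := cube_root_neq F n w cardE w2.
have dvdw : (3 %| #|cubic_fibre F w|)%N.
  by rewrite dvdn3_cubic_fibre // N3 dvdn_mulr.
have dvdw2 : (3 %| #|cubic_fibre F (w ^+ 2)|)%N.
  by rewrite dvdn3_cubic_fibre ?expf_neq0 // N3 dvdn_mulr.
have mulrn_nat (a b : nat) : a *+ b = (a * b)%N by rewrite -mulr_natr natn.
have sumsq := etrans (esym (cubic_fibre_pairs F n cardE))
  (sum_cubic_fibre F nat n w (fun c => #|cubic_fibre F c|) cardE w2).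
have sum1 := sum_cubic_fibre F nat n w (fun=> 1%N) cardE w2.
have card01 : \sum_(y : F | y * (1 - y) != 0) 1%N = (3 * n - 1)%N.
  by rewrite [LHS]sum1_card card_mul_compl_neq0 cardE subSS.
rewrite card01 !mulrn_nat !mul1n in sum1.
rewrite !mulrn_nat in sumsq.
have beta k : (0 < k)%N ->
    \sum_(y : F | y * (1 - y) != 0) ((y * (1 - y)) ^+ n) ^+ k
    = \sum_(y : F) y ^+ (n * k) * (1 - y) ^+ (n * k).
  move=> k_gt0; rewrite big_mkcond; apply: eq_bigr => y _.
  rewrite -exprM exprMn; case: eqP => [y0|//] /=.
  by rewrite -exprMn y0 expr0n muln_eq0 !gtn_eqF.
(* The binomial here is ['C(n, 2 n)], which is 0. *)
have beta1 : \sum_(y : F) y ^+ n * (1 - y) ^+ n = 0.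
  rewrite sum_expr_mul_compl ?N3; [|lia|lia].
  by rewrite bin_small ?mulr0 ?oppr0 //; lia.
have beta2 : \sum_(y : F) y ^+ (n * 2) * (1 - y) ^+ (n * 2) = - 'C(2 * n, n)%:R.
  rewrite sum_expr_mul_compl ?N3; [|lia|lia].
  have -> : (3 * n - n * 2 = n)%N by lia.
  have -> : (-1) ^+ n = 1 :> F.
    have <- : (-1) ^+ 3 = -1 :> F by ring.
    by rewrite -exprM -N3 expf_card_pred // oppr_eq0 oner_eq0.
  by rewrite mul1r mulnC.
have sumF := sum_cubic_fibre F F n w (fun c => c ^+ 1 + c ^+ 2) cardE w2.
rewrite big_split !beta //= !muln1 beta1 beta2 add0r in sumF.
have w12 : w ^+ 1 + w ^+ 2 = -1.
  by apply/eqP; rewrite -subr_eq0 -w2; apply/eqP; ring.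
have w24 : (w ^+ 2) ^+ 1 + (w ^+ 2) ^+ 2 = -1.
  apply/eqP; rewrite -subr_eq0 -(mulr0 (w ^+ 2 - w + 1)) -w2; apply/eqP; ring.
rewrite w12 w24 !expr1n in sumF.
move: #|cubic_fibre F 1| #|cubic_fibre F w| #|cubic_fibre F (w ^+ 2)|
  dvdw dvdw2 sumF sumsq sum1.
move=> N0 N1 N2 /dvdnP[B1 ->] /dvdnP[B2 ->] sumF sumsq sum1.
have int1 : (3 * n)%:Z - 1 = N0%:Z + 3 * B1%:Z + 3 * B2%:Z by lia.
have int2 : (3 * n)%:Z ^+ 2 + 3
    = 3 * (N0%:Z ^+ 2 + 9 * B1%:Z ^+ 2 + 9 * B2%:Z ^+ 2).
  have /(congr1 Posz) := sumsq; rewrite -mulnn !(PoszM, PoszD) => sumsqZ.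
  transitivity (3 * (3 * (n%:Z * n%:Z) + 1)); first ring.
  by rewrite sumsqZ; ring.
(* [L] is minus the trace of the Jacobi sum [N0 + N1 w + N2 w^2], with [w] read as a complex cube
   root of unity, and [3 M = N1 - N2]. *)
exists (3 * B1%:Z + 3 * B2%:Z - 2 * N0%:Z), (B1%:Z - B2%:Z); split.
- have -> : #|F|%:Z = (3 * n)%:Z + 1 by rewrite cardE; lia.
  apply: (@mulfI _ (2 : int)) => //.
  transitivity (4 * ((3 * n)%:Z ^+ 2 + 3 - ((3 * n)%:Z - 1) ^+ 2)); last first.
    by rewrite int2 int1; ring.
  by ring.
- by apply/dvdzP; exists (3 * B1%:Z + 3 * B2%:Z - 2 * n%:Z); lia.
- apply/oppr_inj; rewrite sumF !(rmorphB, rmorphD, rmorphM) /= -!pmulrn.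
  ring.
Qed.

Lemma cube_root_exists (F : finFieldType) :
  #|F| = 1 %[mod 3] -> exists w : F, w ^+ 2 + w + 1 = 0.
Proof.
move=> card1; have [g prim_g] := primitive_root_card F.
have dvd3 : (3 %| #|F|.-1)%N.
  by have := card_predK F; move: card1 => /=; lia.
have prim_w := dvdn_prim_root prim_g dvd3.
set w := g ^+ _ in prim_w; exists w.
have w1 : w - 1 != 0.
  by rewrite subr_eq0 -[w]expr1 -(prim_order_dvd prim_w).
apply: (mulfI w1); transitivity (w ^+ 3 - 1); first by ring.
by rewrite (prim_expr_order prim_w) subrr mulr0.
Qed.

(** * Uniqueness of [L] *)

(** [p] divides [L M' - L' M] or [L M' + L' M], and changing the sign of [M'] exchanges them up to
    sign. Once the first is 0, [M^2 = M'^2], so [L = L'] or [L = - L']; the residue modulo 3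
    excludes the latter. *)
Lemma norm_form27_unique (p : nat) (L M L' M' : int) : prime p ->
  4%:Z * p%:Z = L ^+ 2 + 27%:Z * M ^+ 2 ->
  4%:Z * p%:Z = L' ^+ 2 + 27%:Z * M' ^+ 2 ->
  (3 %| L - 2)%Z -> (3 %| L' - 2)%Z -> L = L'.
Proof.
move=> pr E E' L2 L2'; have p_gt0 := prime_gt0 pr.
wlog dvd_p : M' E' / (p %| L * M' - L' * M)%Z.
  move=> wlog_sign.
  have : (p %| (L * M' - L' * M) * (L * M' + L' * M))%Z.
    apply/dvdzP; exists (4%:Z * (M' ^+ 2 - M ^+ 2)).
    transitivity (4%:Z * p%:Z * M' ^+ 2 - 4%:Z * p%:Z * M ^+ 2); last by ring.
    by rewrite {1}E E'; ring.
  rewrite dvdzE abszM Euclid_dvdM // => /orP[dvd_p|dvd_p].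
    exact: (wlog_sign M').
  apply: (wlog_sign (- M')); first by rewrite sqrrN.
  by rewrite mulrN -opprD dvdzE abszN.
(* Composing the two forms gives [(L L' + 27 M M')^2 + 27 (L M' - L' M)^2]
   [= 16 p^2], so a multiple [L M' - L' M] of [p] must vanish. *)
have D0 : L * M' - L' * M = 0.
  have [k Dk] := dvdzP dvd_p.
  have norm : (L * L' + 27%:Z * (M * M')) ^+ 2 + 27%:Z * (k * p%:Z) ^+ 2
      = 16%:Z * p%:Z ^+ 2.
    rewrite -Dk; transitivity ((4%:Z * p%:Z) * (4%:Z * p%:Z)); last by ring.
    by rewrite {1}E E'; ring.
  rewrite Dk; have [->|nz_k] := eqVneq k 0; first by rewrite mul0r.
  have p2_gt0 : 0 < p%:Z ^+ 2 by rewrite exprn_gt0.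
  have k2_gt0 : 0 < k ^+ 2 by rewrite exprn_even_gt0.
  have : 0 <= 16%:Z * p%:Z ^+ 2 - 27%:Z * (k * p%:Z) ^+ 2.
    by rewrite -norm addrK sqr_ge0.
  rewrite (_ : _ - _ = (16%:Z - 27%:Z * k ^+ 2) * p%:Z ^+ 2); last by ring.
  rewrite (pmulr_lge0 _ p2_gt0); move: (k ^+ 2) k2_gt0 => k2; clear; lia.
have MM : M ^+ 2 = M' ^+ 2.
  apply: (@mulfI _ (4%:Z * p%:Z)); first by rewrite mulf_neq0 // -lt0n.
  move/eqP: D0; rewrite subr_eq0 => /eqP D0.
  rewrite {1}E' E !mulrDl -!exprMn -D0; ring.
have : L ^+ 2 = L' ^+ 2.
  by apply/eqP; rewrite -(inj_eq (addIr (27%:Z * M ^+ 2))) -E {1}MM -E'.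
move/eqP; rewrite eqf_sqr => /orP[/eqP //|/eqP LN].
by move: L2 L2'; rewrite LN; clear; lia.
Qed.

(** * From ['F_p] to congruences between rationals *)

Lemma p_integral_divX (p a m : nat) (c : int) :
  coprime a p -> (0 < a)%N -> p_integral p (c%:~R / a%:R ^+ m).
Proof.
move=> cop a_gt0; rewrite /p_integral; set x := _ / _.
have : (denq x %| (a ^ m)%N%:Z)%Z.
  rewrite -(@Gauss_dvdzr _ (numq x)); last first.
    by rewrite coprimez_sym coprimezE coprime_num_den.
  apply/dvdzP; exists c; apply/(@intr_inj rat).
  rewrite !rmorphM /= numqE -!pmulrn natrX.
  rewrite [x * _]mulrC -mulrA /x mulfVK; first by rewrite mulrC.
  by rewrite expf_neq0 // pnatr_eq0 -lt0n.
move/coprimez_dvdl; apply; rewrite coprimezE; exact: coprimeXl.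
Qed.

(** The numerator of the sum over the denominator [16 ^ [p/6]]; as an integer it maps both to [rat]
    and to ['F_p]. *)
Definition floor_binom_num (p : nat) : int :=
  \sum_(k < (p %/ 6).+1)
    ('C(p %/ 3, k) * 'C(p %/ 6, k))%:Z * (- 9%:Z) ^+ k * 16%:Z ^+ (p %/ 6 - k).

Lemma horner_binom2_floor (R : fieldType) (p : nat) : 16%:R != 0 :> R ->
  (binom2_poly R (p %/ 3) (p %/ 6)).[- (9%:R / 16%:R)]
  = (floor_binom_num p)%:~R / 16%:R ^+ (p %/ 6).
Proof.
move=> nz16; rewrite (horner_coef_wide _ (size_poly _ _)) rmorph_sum mulr_suml.
apply: eq_bigr => k _; rewrite coef_binom2_poly !rmorphM !rmorphXn rmorphN /=.
rewrite -!pmulrn -mulNr exprMn exprVn.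
have le_k : (k <= p %/ 6)%N by rewrite -ltnS.
have -> : 16%:R ^+ (p %/ 6) = 16%:R ^+ (p %/ 6 - k) * 16%:R ^+ k :> R.
  by rewrite -exprD subnK.
by field; rewrite !expf_neq0.
Qed.

Lemma floor_binom_sumE (p : nat) :
  floor_binom_sum p = (floor_binom_num p)%:~R / 16%:R ^+ (p %/ 6).
Proof.
rewrite -horner_binom2_floor // (horner_coef_wide _ (size_poly _ _)).
rewrite /floor_binom_sum big_mkord; apply: eq_bigr => k _.
by rewrite coef_binom2_poly natrM.
Qed.

(** As 16 is a unit modulo [p], the equality in ['F_p] becomes divisibility of an integer by [p];
    the quotient over [16 ^ [p/6]] is the required p-integral factor. *)
Lemma ratcong_floor_binom_sum (p : nat) (L : int) : prime p -> p != 2%N ->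
  (binom2_poly 'F_p (p %/ 3) (p %/ 6)).[- (9%:R / 16%:R)] = L%:~R ->
  ratcong p (floor_binom_sum p) L%:~R.
Proof.
move=> pr p_neq2.
have cop2 : coprime 2 p by rewrite prime_coprime // dvdn_prime2 // eq_sym.
have cop16 : coprime 16 p by rewrite (coprimeXl 4 cop2).
have pchar := pchar_Fp pr.
have nz16 : 16%:R != 0 :> 'F_p.
  by rewrite -(dvdn_pcharf pchar) -prime_coprime // coprime_sym.
rewrite horner_binom2_floor // floor_binom_sumE; set m := (p %/ 6)%N.
set s := floor_binom_num p; move=> eqF.
have : (p %| s - L * 16%:Z ^+ m)%Z.
  rewrite (dvdz_pcharf pchar) rmorphB rmorphM rmorphXn /= -!pmulrn -eqF.
  by rewrite mulfVK ?subrr // expf_neq0.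
case/dvdzP => c Ec; split; first exact: p_integral_divX.
  by have := p_integral_divX p 1 0 L (coprime1n p) isT; rewrite expr0 divr1.
exists (c%:~R / 16%:R ^+ m); first exact: p_integral_divX.
have -> : s = c * p%:Z + L * 16%:Z ^+ m by rewrite -Ec subrK.
rewrite rmorphD !rmorphM rmorphXn /= -!pmulrn; field.
by rewrite expf_neq0.
Qed.

Theorem theorem4p8 (p : nat) (p_prime : prime p) (p_gt3 : (3 < p)%N)
    (p_neq5 : p <> 5%N) :
  ((p = 1 %[mod 3])%N ->
     forall L M : int,
       4%:Z * p%:Z = L ^+ 2 + 27%:Z * M ^+ 2 ->
       (3 %| L - 2)%Z ->
       ratcong p (floor_binom_sum p) L%:~R)
  /\
  ((p = 2 %[mod 3])%N -> ratcong p (floor_binom_sum p) 0).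
Proof.
have p_neq2 : p != 2%N by rewrite neq_ltn (ltn_trans _ p_gt3) ?orbT.
have cardE := card_Fp p_prime.
have pr : prime #|'F_p| by rewrite cardE.
have nz (l : nat) : (0 < l < p)%N -> l%:R != 0 :> 'F_p.
  by case/andP => l0 ltl; rewrite natf_eq0_card // cardE gtnNdvd.
have nz3 : 3%:R != 0 :> 'F_p := nz 3%N p_gt3.
have nz2 : 2%:R != 0 :> 'F_p := nz 2%N (ltnW p_gt3).
have := horner_binom2_trinom 'F_p pr nz3 nz2.
rewrite cardE; set S := _.[_] => Seq; split=> [p1 L M normL L2 | p2].
  have F1 : #|'F_p| = 1 %[mod 3] by rewrite cardE.
  have [w w2] := cube_root_exists 'F_p F1.
  have cardn : #|'F_p| = (3 * (p %/ 3)).+1.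
    by rewrite cardE {1}(divn_eq p 3) p1 addn1 mulnC.
  have [L' [M' [normL' L2' LF]]] := jacobi_binomial 'F_p _ w cardn w2.
  rewrite cardE in normL'.
  (* Uniqueness identifies the given [L] with the one coming from the Jacobi sum. *)
  have -> := norm_form27_unique p L M L' M' p_prime normL normL' L2 L2'.
  apply: ratcong_floor_binom_sum => //; rewrite -/S LF.
  have := hesse_sum_1mod3 'F_p w pr nz3 nz2 F1 w2.
  by rewrite cardE => <-; rewrite -Seq p1 /= mul1r.
have F2 : #|'F_p| = 2 %[mod 3] by rewrite cardE.
apply: (ratcong_floor_binom_sum p 0) => //; rewrite -/S.
have := hesse_sum_2mod3 'F_p pr nz3 nz2 F2; rewrite cardE -Seq p2 /=.
(* The factor 5/4 from the quadratic transformation has to be cancelled, which is where [p = 5] must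
   be excluded. *)
have nz5 : 5%:R != 0 :> 'F_p.
  have p_neq4 : p != 4%N by apply: contraTneq p_prime => ->.
  by apply: nz; move: p_gt3 p_neq4 p_neq5; clear; lia.
have nz4 : 4%:R != 0 :> 'F_p by rewrite (natrM _ 2 2) mulf_neq0.
by move/eqP; rewrite !mulf_eq0 invr_eq0 (negPf nz5) (negPf nz4) /= => /eqP.
Qed.
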